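(* Let $n,k$ be integers with $k\ge1$, $n>2k$. Then $\beta(P(n,k))=n+1$ if and only if either $n$ is odd and $k=1$, or $(n,k)=(5,2)$.
   Context: $P(n,k)$ is the generalized Petersen graph with vertices $u_1,\dots,u_n,v_1,\dots,v_n$ and edges $u_iu_{i+1}$, $u_iv_i$, $v_iv_{i+k}$ (subscripts modulo $n$). $\beta(G)$ denotes the size of a minimum vertex cover of $G$. *)

(* Defs.v *)
From mathcomp Require Import all_boot.

Set Implicit Arguments.
Unset Strict Implicit.
Unset Printing Implicit Defensive.

(* A graph is given by its adjacency relation on a finite vertex type. *)
Section VertexCover.
Variables (T : finType) (e : rel T).

Definition vertex_cover (S : {set T}) : bool :=
  [forall x, forall y, e x y ==> (x \in S) || (y \in S)].

Lemma vertex_cover_setT : vertex_cover [set: T].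
Proof. by apply/forallP=> x; apply/forallP=> y; rewrite inE implybT. Qed.

(* [set: T] is only the default required by arg min; it is always a vertex
   cover, so the minimum is genuinely attained (cf. vertex_cover_numberP). *)
Definition vertex_cover_number : nat :=
  #|[arg min_(S < [set: T] | vertex_cover S) #|S| ]|.

Lemma vertex_cover_numberP :
  (exists2 S, vertex_cover S & #|S| = vertex_cover_number) /\
  (forall S, vertex_cover S -> vertex_cover_number <= #|S|).
Proof.
rewrite /vertex_cover_number.
case: arg_minnP => [|S covS minS]; first exact: vertex_cover_setT.
by split; [exists S | exact: minS].
Qed.

End VertexCover.

(* Vertices are 'I_n + 'I_n: inl i is u_i and inr i is v_i, with i in
   {0, ..., n-1} representing the subscripts modulo n. Each edge is listed once,
   with an orientation, and the relation is then symmetrized. *)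
Definition gpetersen_arc (n k : nat) : rel ('I_n + 'I_n) :=
  fun x y =>
  match x, y with
  | inl i, inl j => val j == (i + 1) %% n
  | inl i, inr j => i == j
  | inr i, inr j => val j == (i + k) %% n
  | inr _, inl _ => false
  end.

Definition gpetersen (n k : nat) : rel ('I_n + 'I_n) :=
  fun x y => gpetersen_arc k x y || gpetersen_arc k y x.

Lemma gpetersen_sym (n k : nat) : symmetric (@gpetersen n k).
Proof. by move=> x y; rewrite /gpetersen orbC. Qed.

Lemma gpetersen_irr (n k : nat) :
  1 <= k -> 2 * k < n -> irreflexive (@gpetersen n k).
Proof.
move=> k_gt0 n_gt2k; have k_lt_n : k < n.
  by apply: leq_ltn_trans n_gt2k; rewrite leq_pmull.
have shift_neq (d : nat) (i : 'I_n) : 0 < d -> d < n ->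
    (val i == (i + d) %% n) = false.
  move=> d_gt0 d_lt_n; apply/negbTE/negP=> /eqP ii.
  have : i + 0 == i + d %[mod n] by rewrite addn0 -ii modn_small.
  by rewrite eqn_modDl mod0n modn_small // eq_sym eqn0Ngt d_gt0.
have n_gt1 : 1 < n by exact: leq_ltn_trans k_gt0 k_lt_n.
by case=> i; rewrite /gpetersen orbb /= shift_neq.
Qed.

(* Main.v *)
(* At most one end of each spoke u_i v_i lies outside a vertex cover, so a cover
   has n + d vertices, d being the number of doubly covered spokes. When d = 1,
   number the spokes from the doubly covered one and let V j say that v_j is
   uncovered: V is true at one of any two consecutive positions, and is not
   true at two positions k apart. Two consecutive uncovered v's push conflicts
   k steps to the left and to the right, which only the exceptional spoke can
   absorb; this forces n = 2k+1 and determines their position. Otherwise V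
   alternates, and a parity count at distances k and n - k concludes. *)
Require Import Defs.
From mathcomp Require Import all_boot.
From mathcomp Require Import zify.

Set Implicit Arguments.
Unset Strict Implicit.
Unset Printing Implicit Defensive.

(** * Boolean sequences with one exceptional position *)

Lemma alternating_odd (V : nat -> bool) (a b : nat) :
    (forall j, a <= j < b -> V j.+1 = ~~ V j) ->
  forall d, a + d <= b -> V (a + d) = odd d (+) V a.
Proof.
move=> alt; elim=> [|d IHd] le_b; first by rewrite addn0.
by rewrite addnS alt ?IHd ?oddS ?addNb //; lia.
Qed.

(** Position 0 is the exceptional spoke, so only positions 1 to n-1 are constrained. [wrap] is the
    inner edge that passes position 0: k steps after j + (n - k) comes j again. *)
Lemma one_defect_parity (n k : nat) (V : nat -> bool) :
    0 < k -> 2 * k < n ->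
    (forall j, 0 < j -> j.+1 < n -> V j || V j.+1) ->
    (forall j, 0 < j -> j + k < n -> ~~ (V j && V (j + k))) ->
    (forall j, 0 < j -> j + (n - k) < n -> ~~ (V j && V (j + (n - k)))) ->
  [\/ odd n /\ k = 1, n = 5 /\ k = 2 | ~~ odd n /\ odd k].
Proof.
move=> k_gt0 n_gt2k adj step wrap.
(* If k < j, then [V] fails at j-k and j-k+1, against [adj]; if j+k+1 < n, it fails at j+k and
   j+k+1. Hence n <= j+k+1 <= 2k+1. *)
have pairVV j : 0 < j -> j.+1 < n -> V j -> V j.+1 -> j = k /\ n = (2 * k).+1.
  move=> j_gt0 lt_jn Vj Vj1.
  have le_jk : j <= k.
    rewrite leqNgt; apply/negP=> lt_kj.
    have := step (j - k) ltac:(lia) ltac:(lia).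
    have := step (j - k).+1 ltac:(lia) ltac:(lia).
    rewrite addSn subnK ?Vj ?Vj1 ?andbT; last lia.
    by have := adj (j - k) ltac:(lia) ltac:(lia); do 2!case: (V _).
  have le_njk : n <= (j + k).+1.
    rewrite leqNgt; apply/negP=> lt_n.
    have := step j ltac:(lia) ltac:(lia).
    have := step j.+1 ltac:(lia) ltac:(lia).
    rewrite addSn Vj Vj1 /=.
    by have := adj (j + k) ltac:(lia) ltac:(lia); do 2!case: (V _).
  lia.
have altE j : 0 < j -> j.+1 < n -> ~~ (V j && V j.+1) -> V j.+1 = ~~ V j.
  by move=> j_gt0 lt_jn; have := adj j j_gt0 lt_jn; case: (V j); case: (V _).
have [/andP[/eqP n_eq /andP[Vk Vk1]] | noVV] :=
    boolP ((n == (2 * k).+1) && (V k && V k.+1)).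
  have [k1|k_neq1] := eqVneq k 1; first by constructor 1; lia.
  have [k2|k_neq2] := eqVneq k 2; first by constructor 2; lia.
  have altV j : 0 < j -> j.+1 < n -> j != k -> V j.+1 = ~~ V j.
    move=> j_gt0 lt_jn j_neqk; apply: altE => //.
    by apply/negP=> /andP[Vj /(pairVV _ j_gt0 lt_jn Vj)[]]; lia.
  (* The pair at k, k+1 is the only break, so [V] alternates on each half separately. *)
  have lowV d : 1 + d <= k -> V (1 + d) = odd d (+) V 1.
    by apply: alternating_odd => j /andP[j_gt0 lt_jk]; apply: altV; lia.
  have highV d : k.+1 + d <= 2 * k -> V (k.+1 + d) = odd d (+) V k.+1.
    by apply: alternating_odd => j /andP[lt_kj le_j2k]; apply: altV; lia.
  have V1E : odd k = V 1.
    have := lowV k.-1; rewrite add1n prednK // Vk => /(_ (leqnn k)).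
    have -> : odd k.-1 = ~~ odd k by lia.
    by case: (V 1); case: (odd k).
  (* [V 1] fails because [V k.+1] holds, so k is even. Then [V 2] and [V (k + 3)] hold, against
     [wrap]; k >= 3 puts k+3 within the upper half. *)
  have := step 1 ltac:(lia) ltac:(lia).
  rewrite add1n Vk1 andbT -V1E => /negPf k_even.
  have := wrap 2 ltac:(lia) ltac:(lia).
  have -> : 2 + (n - k) = k.+1 + 2 by lia.
  have -> : V (k.+1 + 2) by rewrite highV ?Vk1 //; lia.
  by have -> : V 2 by rewrite (lowV 1) -?V1E ?k_even //; lia.
have altV j : 0 < j < n.-1 -> V j.+1 = ~~ V j.
  move=> /andP[j_gt0 lt_jn]; apply: altE => //; first lia.
  apply/negP=> /andP[Vj Vj1].
  have [jk nk] := pairVV j j_gt0 ltac:(lia) Vj Vj1.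
  by rewrite nk eqxx -jk Vj Vj1 in noVV.
have VE d : 1 + d <= n.-1 -> V (1 + d) = odd d (+) V 1.
  exact: alternating_odd.
(* A shift by an even k preserves [V], so [V 1] and [V 2] would both fail. *)
have [k_odd | k_even] := boolP (odd k); last first.
  have := step 1 ltac:(lia) ltac:(lia).
  have := step 2 ltac:(lia) ltac:(lia).
  have -> : V (2 + k) = ~~ V 1.
    by rewrite (_ : 2 + k = 1 + k.+1) // VE ?oddS ?k_even //; lia.
  have -> : V (1 + k) = V 1 by rewrite VE ?(negPf k_even) //; lia.
  have -> : V 2 = ~~ V 1 by apply: (VE 1); lia.
  by case: (V 1).
have [n_odd | n_even] := boolP (odd n); last by constructor 3.
have [k1|k_neq1] := eqVneq k 1; first by constructor 1.
(* Now the even shift is n - k; k >= 3 keeps 2 + (n - k) below n. *)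
have /negPf nk_even : ~~ odd (n - k) by lia.
have := wrap 1 ltac:(lia) ltac:(lia).
have := wrap 2 ltac:(lia) ltac:(lia).
have -> : V (2 + (n - k)) = ~~ V 1.
  by rewrite (_ : 2 + (n - k) = 1 + (n - k).+1) // VE ?oddS ?nk_even //; lia.
have -> : V (1 + (n - k)) = V 1 by rewrite VE ?nk_even //; lia.
have -> : V 2 = ~~ V 1 by apply: (VE 1); lia.
by case: (V 1).
Qed.

(** * Covers counted spoke by spoke *)

Section Covers.
Variables (n k : nat).
Implicit Types (S : {set 'I_n + 'I_n}).

Lemma gpetersen_coverP S :
  reflect
    [/\ forall i, (inl i \in S) || (inr i \in S),
        forall i j : 'I_n, j = (i + 1) %% n :> nat ->
          (inl i \in S) || (inl j \in S)
      & forall i j : 'I_n, j = (i + k) %% n :> nat ->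
          (inr i \in S) || (inr j \in S)]
    (vertex_cover (@gpetersen n k) S).
Proof.
apply: (iffP forallP) => [cov | [spoke outer inner] x].
  have edge x y : gpetersen_arc k x y -> (x \in S) || (y \in S).
    by move=> xy; have /forallP/(_ y) := cov x; rewrite /gpetersen xy.
  by split=> [i | i j ij | i j ij]; apply: edge => /=; rewrite ?eqxx ?ij.
have arcP x' y' : gpetersen_arc k x' y' -> (x' \in S) || (y' \in S).
  case: x' y' => i [] j //= => [/eqP/outer|/eqP<-|/eqP/inner] //.
by apply/forallP=> y; apply/implyP=> /orP[/arcP|/arcP] //; rewrite orbC.
Qed.

Definition double_spokes S : {set 'I_n} :=
  [set i | (inl i \in S) && (inr i \in S)].

Lemma card_gpetersen_cover S :
  (forall i, (inl i \in S) || (inr i \in S)) ->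
  #|S| = n + #|double_spokes S|.
Proof.
move=> spoke.
rewrite -sum1_card big_mkcond big_sumType /= -big_split /=.
rewrite -[X in X + _]card_ord -sum1_card -sum1_card [X in _ = _ + X]big_mkcond.
rewrite -big_split; apply: eq_bigr => i _ /=; rewrite inE.
by have := spoke i; case: (_ \in S); case: (_ \in S).
Qed.

End Covers.

(** * Reading a cover as a periodic sequence from a base spoke *)

Section Unrolling.
Variables (n k : nat) (n_gt0 : 0 < n) (S : {set 'I_n + 'I_n}) (i0 : nat).
Hypothesis cov : vertex_cover (@gpetersen n k) S.

Definition spoke_at (j : nat) : 'I_n := Ordinal (ltn_pmod (i0 + j) n_gt0).

Definition outer_covered (j : nat) : bool := inl (spoke_at j) \in S.

Definition single_at (j : nat) : bool := spoke_at j \notin double_spokes S.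

Lemma spoke_at_modn j : spoke_at (j + n) = spoke_at j.
Proof. by apply: val_inj; rewrite /= addnA modnDr. Qed.

Lemma outer_covered_adj j : outer_covered j || outer_covered j.+1.
Proof.
have [_ outer _] := gpetersen_coverP _ _ cov.
by apply: outer; rewrite /= modnDml -addnA addn1.
Qed.

(* On a singly covered spoke, "outer end covered" means "inner end uncovered". *)
Lemma outer_covered_step j l :
    single_at j -> single_at l -> l = j + k %[mod n] ->
  ~~ (outer_covered j && outer_covered l).
Proof.
have [_ _ inner] := gpetersen_coverP _ _ cov.
rewrite /single_at !inE /outer_covered => sj sl jl.
have := inner (spoke_at j) (spoke_at l).
rewrite /= modnDml -addnA -modnDmr jl modnDmr => /(_ erefl).
by move: sj sl; do 4!case: (_ \in S).
Qed.

End Unrolling.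

(** * Explicit covers and lower bounds *)

Lemma vertex_cover_number_eq (T : finType) (e : rel T) (m : nat) (S : {set T}) :
    vertex_cover e S -> #|S| <= m ->
    (forall S', vertex_cover e S' -> m <= #|S'|) ->
  vertex_cover_number e = m.
Proof.
move=> covS leSm minm; have [[S' cov' <-] min'] := vertex_cover_numberP e.
by apply/eqP; rewrite eqn_leq minm // (leq_trans (min' _ covS)).
Qed.

Lemma gpetersen_cover_ge (n k : nat) (S : {set 'I_n + 'I_n}) :
  vertex_cover (@gpetersen n k) S -> n <= #|S|.
Proof.
by case/gpetersen_coverP=> spoke _ _; rewrite card_gpetersen_cover // leq_addr.
Qed.

(** A colour class of the bipartition when n is even and k is odd. *)
Definition parity_cover (n : nat) : {set 'I_n + 'I_n} :=
  [set x : 'I_n + 'I_n | match x with inl i => odd i | inr i => ~~ odd i end].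

Lemma card_parity_cover (n : nat) : #|parity_cover n| = n.
Proof.
rewrite card_gpetersen_cover => [|i]; last by rewrite !inE orbN.
rewrite (_ : double_spokes _ = set0) ?cards0 ?addn0 //.
by apply/setP=> i; rewrite !inE andbN.
Qed.

Lemma vertex_cover_number_bipartite (n k : nat) :
  ~~ odd n -> odd k -> vertex_cover_number (@gpetersen n k) = n.
Proof.
move=> n_even k_odd.
apply: (@vertex_cover_number_eq _ _ _ (parity_cover n)).
- have odd_mod i : odd (i %% n) = odd i by rewrite odd_mod // (negPf n_even).
  apply/gpetersen_coverP; split=> [i|i j ij|i j ij]; rewrite !inE ?orbN //.
    by rewrite ij odd_mod addn1 orbN.
  by rewrite ij odd_mod oddD k_odd addbT orbN.
- by rewrite card_parity_cover.
- exact: gpetersen_cover_ge.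
Qed.

(** A cover of size n has no doubly covered spoke, so the constraints on [V] hold all around the
    cycle. For k = 1 they make [V] alternate on an odd cycle. *)
Lemma gpetersen_cover_gt (n k : nat) (S : {set 'I_n + 'I_n}) :
    odd n /\ k = 1 \/ n = 5 /\ k = 2 ->
  vertex_cover (@gpetersen n k) S -> n < #|S|.
Proof.
move=> nk cov; have n_gt0 : 0 < n by lia.
have [spoke _ _] := gpetersen_coverP _ _ cov.
rewrite card_gpetersen_cover // -[ltnLHS]addn0 ltn_add2l lt0n cards_eq0.
apply/eqP=> no_double.
have single j : single_at n_gt0 S 0 j by rewrite /single_at no_double inE.
pose V := outer_covered n_gt0 S 0.
have Vadj j : V j || V j.+1 by exact: outer_covered_adj cov j.
have Vstep j : ~~ (V j && V (j + k)).
  by apply: (outer_covered_step cov (single j)).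
have Vmod j : V (j + n) = V j by rewrite /V /outer_covered spoke_at_modn.
case: nk => [[n_odd k1] | [n5 k2]].
  have alt j : 0 <= j < n -> V j.+1 = ~~ V j.
    by move=> _; have := Vadj j; have := Vstep j; rewrite k1 addn1; do 2!case: (V _).
  have := alternating_odd alt (leqnn n); rewrite Vmod n_odd.
  by case: (V 0).
rewrite {}n5 {}k2 in Vstep Vmod.
(* Consecutive positions form a 5-cycle, which forces three true values; positions at distance 2
   form another, which allows at most two. *)
have step2 j : ~~ (V j && V j.+2) by rewrite -addn2.
have V5 : V 5 = V 0 := Vmod 0; have V6 : V 6 = V 1 := Vmod 1.
move: (step2 0) (step2 1) (step2 2) (step2 3) (step2 4) (Vadj 0) (Vadj 1)
      (Vadj 2) (Vadj 3) (Vadj 4).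
by rewrite V5 V6; do 5!case: (V _).
Qed.

(** For odd n, [parity_cover] misses only the closing outer edge, from index n-1 to index 0, both
    even; adding the outer vertex 0 repairs it. The closing inner edge has both ends covered. *)
Lemma vertex_cover_number_odd_prism (n : nat) :
  odd n -> vertex_cover_number (@gpetersen n 1) = n + 1.
Proof.
move=> n_odd; have n_gt0 : 0 < n by case: n n_odd.
apply: (@vertex_cover_number_eq _ _ _ (inl (Ordinal n_gt0) |: parity_cover n)).
- apply/gpetersen_coverP; split=> [i|i j ij|i j ij].
  + by rewrite !inE orbACA orbN orbT.
  + have [lt_in | le_ni] := ltnP (i + 1) n.
      by rewrite !inE ij modn_small // addn1 /= orbACA orbN orbT.
    have j0 : j = Ordinal n_gt0.
      apply: val_inj => /=; rewrite ij (_ : i + 1 = n) ?modnn //.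
      by have := ltn_ord i; lia.
    by rewrite j0 !inE eqxx orbT.
  + have [lt_in | le_ni] := ltnP (i + 1) n.
      by rewrite !inE ij modn_small // addn1 /= negbK orNb.
    have i_n : i + 1 = n by have := ltn_ord i; lia.
    by rewrite !inE ij i_n modnn orbT.
- rewrite cardsU1 card_parity_cover addnC leq_add2l; exact: leq_b1.
- by move=> S; rewrite addn1; apply: gpetersen_cover_gt; left.
Qed.

Lemma vertex_cover_number_petersen :
  vertex_cover_number (@gpetersen 5 2) = 6.
Proof.
apply: (@vertex_cover_number_eq _ _ _
  [set x : 'I_5 + 'I_5 | match x with
     | inl i => (i : nat) \in [:: 1; 3; 4] | inr i => i < 3 end]).
- apply/gpetersen_coverP; split=> [[i lti]|[i lti] j ij|[i lti] j ij].
  + by rewrite !inE /=; move: i lti; do 5!case=> //.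
  + by rewrite !inE ij /= => {ij}; move: i lti; do 5!case=> //.
  + by rewrite !inE ij /= => {ij}; move: i lti; do 5!case=> //.
- rewrite card_gpetersen_cover => [|[i lti]]; last first.
    by rewrite !inE /=; move: i lti; do 5!case=> //.
  (* Index 1 is the only one in both {1, 3, 4} and {0, 1, 2}. *)
  rewrite (_ : double_spokes _ = [set Ordinal (isT : 1 < 5)]) ?cards1 //.
  by apply/setP=> -[i lti]; rewrite !inE -val_eqE /=; move: i lti; do 5!case=> //.
- by move=> S; apply: gpetersen_cover_gt; right.
Qed.

Theorem theorem15 (n k : nat) (hk : 1 <= k) (hn : 2 * k < n) :
  vertex_cover_number (@gpetersen n k) = n + 1 <->
  (odd n /\ k = 1) \/ (n = 5 /\ k = 2).
Proof.
split=> [beta | [[n_odd ->] | [-> ->]]]; last 2 first.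
- exact: vertex_cover_number_odd_prism.
- exact: vertex_cover_number_petersen.
have [[S cov cardS] _] := vertex_cover_numberP (@gpetersen n k).
have [spoke _ _] := gpetersen_coverP _ _ cov.
have /eqP/cards1P[i0 double] : #|double_spokes S| = 1.
  by apply/(@addnI n); rewrite -card_gpetersen_cover // cardS.
have n_gt0 : 0 < n by lia.
have single j : 0 < j < n -> single_at n_gt0 S i0 j.
  move=> /andP[j_gt0 lt_jn]; rewrite /single_at double inE.
  apply/negP=> /eqP/(congr1 val) /= /eqP.
  rewrite -[X in _ == X](modn_small (ltn_ord i0)) -[X in _ == X %[mod _]]addn0.
  by rewrite eqn_modDl mod0n modn_small //; lia.
pose V := outer_covered n_gt0 S i0.
have Vadj j : V j || V j.+1 by exact: outer_covered_adj cov j.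
have Vstep j l : 0 < j < n -> 0 < l < n -> l = j + k %[mod n] -> ~~ (V j && V l).
  by move=> /single sj /single sl; apply: (outer_covered_step cov).
case: (@one_defect_parity n k V hk hn) => [//|j j_gt0 ltn|j j_gt0 ltn|||].
- by apply: Vstep; lia.
(* The edge is read backwards: adding k to j + (n - k) gives j modulo n. *)
- rewrite andbC; apply: Vstep; try lia.
  by rewrite -addnA subnK ?modnDr //; lia.
- by left.
- by right.
(* In the remaining case the graph is bipartite and the minimum is n, not n + 1. *)
case=> n_even k_odd; move: beta.
by rewrite vertex_cover_number_bipartite //; lia.
Qed.
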